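(* Let $(X,d)$ be a metric space and let $\phi_n:X\to X$, $n=1,2,\ldots$, be a sequence of continuous maps. If $(X,\phi_{1,\infty})$ is $\aleph_0$-expansive, then it is cw-expansive.
   Context: For a sequence of continuous maps $\phi_{1,\infty}=\{\phi_n\}_{n=1}^\infty$ on $X$, write $\phi_1^n=\phi_n\circ\phi_{n-1}\circ\cdots\circ\phi_1$ for $n\ge 1$; here $\mathbb{N}=\{1,2,\ldots\}$. The system $(X,\phi_{1,\infty})$ is $\aleph_0$-expansive if there is $c>0$ such that for every $x\in X$ the set $\{y\in X: d(\phi_1^i(x),\phi_1^i(y))\le c\text{ for all } i\in\mathbb{N}\}$ is at most countable. A subcontinuum of $X$ is a nonempty subset that is compact and connected in the induced topology; it is non-degenerate if it has more than one point. The system $(X,\phi_{1,\infty})$ is continuum-wise expansive (cw-expansive) if there is $c>0$ such that every non-degenerate subcontinuum $C$ of $X$ satisfies $\operatorname{diam}(\phi_1^n(C))>c$ for some $n\in\mathbb{N}$. *)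

(* Defs.v *)
From mathcomp Require Import all_boot all_order all_algebra.
From mathcomp Require Import all_classical all_reals all_analysis.

Set Implicit Arguments.
Unset Strict Implicit.
Unset Printing Implicit Defensive.

Local Open Scope classical_set_scope.
Local Open Scope ring_scope.

(* phi_1^n = phi_n \o ... \o phi_1: the maps are indexed from 1, so [phi 0] is
   never used, and phi_1^0 is the identity. *)
Fixpoint comp_upto (X : Type) (phi : nat -> X -> X) (n : nat) : X -> X :=
  if n is m.+1 then phi n \o comp_upto phi m else id.

(* An extended real, so that it is meaningful for unbounded sets; the diameter
   of the empty set is -oo here. *)
Definition diam (R : realType) (X : metricType R) (A : set X) : \bar R :=
  ereal_sup [set (mdist p.1 p.2)%:E | p in A `*` A].

Definition subcontinuum (X : topologicalType) (C : set X) : Prop :=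
  [/\ C !=set0, compact C & connected C].

Definition nondegenerate (X : Type) (C : set X) : Prop :=
  exists x y, [/\ C x, C y & x <> y].

Definition aleph0_expansive (R : realType) (X : metricType R)
    (phi : nat -> X -> X) : Prop :=
  exists2 c : R, 0 < c & forall x : X,
    countable [set y : X | forall i : nat, (0 < i)%N ->
      mdist (comp_upto phi i x) (comp_upto phi i y) <= c].

Definition cw_expansive (R : realType) (X : metricType R)
    (phi : nat -> X -> X) : Prop :=
  exists2 c : R, 0 < c & forall C : set X,
    subcontinuum C -> nondegenerate C ->
    exists2 n : nat, (0 < n)%N & (c%:E < diam (comp_upto phi n @` C))%E.

(* Main.v *)
Require Import Defs.
From mathcomp Require Import all_boot all_order all_algebra.
From mathcomp Require Import all_classical all_reals all_analysis.

(** If no iterate spreads a non-degenerate continuum [C] beyond [c], then [C]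
    lies in the dynamical [c]-ball of each of its points [x], so it is
    countable; but [y |-> d(x, y)] maps [C] onto a non-trivial interval. *)

Set Implicit Arguments.
Unset Strict Implicit.
Unset Printing Implicit Defensive.

Import Order.TTheory GRing.Theory Num.Theory.
Import numFieldNormedType.Exports.

Local Open Scope classical_set_scope.
Local Open Scope ring_scope.

(** The triangle inequality makes the distance to [x] 1-Lipschitz, so [e] itself serves as the
    radius. *)
Lemma mdist_continuous (R : realType) (X : metricType R) (x : X) :
  continuous (mdist x : X -> R).
Proof.
move=> y; apply/cvgrPdist_lt => e e0; near=> z.
have : ball y e z by near: z; exact: nbhsx_ballx.
rewrite ballEmdist /= => yz; apply: le_lt_trans yz.
rewrite ler_norml; apply/andP; split.
  by rewrite lerBrDr addrC lerBlDr metric_triangle.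
by rewrite lerBlDl (metric_sym y z) metric_triangle.
Unshelve. all: by end_near. Qed.

(** A countable set has Lebesgue measure zero, whereas this interval has measure [b - a > 0]. *)
Lemma uncountable_itv_cc (R : realType) (a b : R) :
  a < b -> ~ countable `[a, b]%classic.
Proof.
move=> ab /countable_lebesgue_measure0.
rewrite lebesgue_measure_itv /= lte_fin ab -EFinB => -[/eqP].
by rewrite subr_eq0 gt_eqF.
Qed.

Lemma uncountable_connected (R : realType) (X : metricType R) (C : set X) :
  connected C -> Defs.nondegenerate C -> ~ countable C.
Proof.
move=> Cconn [x [y [Cx Cy /eqP xy]]] Ccount.
have /connected_intervalP fC_itv : connected (mdist x @` C : set R).
  apply: connected_continuous_connected => //.
  exact/continuous_subspaceT/mdist_continuous.
have d0 : 0 < mdist x y by rewrite mdist_gt0.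
apply: (uncountable_itv_cc d0).
(* The image of [C] is countable, and it is an interval containing [0 = mdist x x] and [mdist x y],
   hence all of the segment between them. *)
apply: sub_countable (sub_countable (card_image_le (mdist x) C) Ccount).
apply: subset_card_le => t; rewrite /= in_itv /=.
by apply: fC_itv; [exists x; rewrite ?mdistxx | exists y].
Qed.

Lemma mdist_le_diam (R : realType) (X : metricType R) (A : set X) (x y : X) :
  A x -> A y -> ((mdist x y)%:E <= diam A)%E.
Proof. by move=> Ax Ay; apply: ereal_sup_ubound; exists (x, y). Qed.

Theorem theorem3p10 (R : realType) (X : metricType R) (phi : nat -> X -> X)
  (phi_cont : forall n : nat, (0 < n)%N -> continuous (phi n)) :
  aleph0_expansive phi -> cw_expansive phi.
Proof.
move=> [c c0 ball_count]; exists c => // C [_ _ Cconn] Cnd.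
apply: contrapT => small.
have [x [_ [Cx _ _]]] := Cnd.
apply: (uncountable_connected Cconn Cnd).
apply: sub_countable (ball_count x); apply: subset_card_le => y Cy i i0.
(* If the [i]-th iterates of [x] and [y] were more than [c] apart, these two points of the image of
   [C] would force its diameter above [c], contradicting [small]. *)
rewrite -lee_fin leNgt; apply/negP => ci; apply: small; exists i => //.
by apply: (lt_le_trans ci); apply: mdist_le_diam; [exists x | exists y].
Qed.
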